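(* Let $\{\alpha_n\}_{n\in\mathbb{N}}\subset(0,d)$ be such that $\alpha_n\to d^-$ as $n\to+\infty$. For every $u\in L^2(\Omega)$ and for every $\{u^n\}_{n\in\mathbb{N}}\subset L^2(\Omega)$ with $u^n\rightharpoonup u$ weakly in $L^2(\Omega)$ it holds $$\lim_{n\to+\infty}\mathcal{J}^{\alpha_n}(u^n)=\mathcal{J}^d(u).$$ In particular, as $\alpha\to d^-$, the functionals $\mathcal{J}^\alpha$ (respectively $-\mathcal{J}^\alpha$) $\Gamma$-converge to the functional $\mathcal{J}^d$ (respectively $-\mathcal{J}^d$) with respect to the weak convergence in $L^2(\Omega)$.
   Context: Let $d\in\mathbb{N}$ (with $d\ge 1$) and let $\Omega\subset\mathbb{R}^d$ be a bounded open set with Lipschitz continuous boundary. $L^2(\Omega)$ is the space of real-valued square-integrable functions. For $\alpha\in(0,d)$ and $u\in L^2(\Omega)$ set $$\mathcal{J}^\alpha(u):=-\int_\Omega\int_\Omega\frac{u(x)u(y)}{|x-y|^{d-\alpha}}\,dy\,dx\in\mathbb{R},\qquad \mathcal{J}^d(u):=-\Big(\int_\Omega u(x)\,dx\Big)^2.$$ $\Gamma$-convergence of functionals $F^\alpha$ to $F$ as $\alpha\to d^-$ with respect to weak $L^2$ convergence is understood sequentially: for every sequence $\alpha_n\to d^-$ in $(0,d)$, (liminf) $F(u)\le\liminf_n F^{\alpha_n}(u^n)$ whenever $u^n\rightharpoonup u$ weakly in $L^2(\Omega)$, and (limsup) for every $u\in L^2(\Omega)$ there is a sequence $u^n\rightharpoonup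 u$ weakly in $L^2(\Omega)$ with $F^{\alpha_n}(u^n)\to F(u)$. *)

(* Defs.v *)
From HB Require Import structures.
From mathcomp Require Import all_boot all_order all_algebra.
From mathcomp Require Import all_classical all_reals all_analysis.

Set Implicit Arguments.
Unset Strict Implicit.
Unset Printing Implicit Defensive.

Import Order.TTheory GRing.Theory Num.Theory.
Import numFieldNormedType.Exports.

Local Open Scope classical_set_scope.
Local Open Scope ring_scope.

(* The sigma-algebra on row vectors is the product of the Borel sigma-algebras
   of the coordinates, as the library does for tuples; it contains all open
   sets by [open_measurable_rV], so it is the Borel sigma-algebra. *)
Section measurable_rV.
Context {R : realType} (n : nat).

Let coord (i : 'I_n) (v : 'rV[R]_n) : measurableTypeR R := v ord0 i.

Let rV_set0 : g_sigma_preimage coord set0.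
Proof. exact: sigma_algebra0. Qed.

Let rV_setC A : g_sigma_preimage coord A -> g_sigma_preimage coord (~` A).
Proof. exact: sigma_algebraC. Qed.

Let rV_bigcup (F : (set 'rV[R]_n)^nat) :
  (forall i, g_sigma_preimage coord (F i)) ->
  g_sigma_preimage coord (\bigcup_i F i).
Proof. exact: sigma_algebra_bigcup. Qed.

HB.instance Definition _ := @isMeasurable.Build default_measure_display
  'rV[R]_n (g_sigma_preimage coord) rV_set0 rV_setC rV_bigcup.

Lemma measurable_coord_rV (i : 'I_n) :
  measurable_fun [set: 'rV[R]_n] (fun v => v ord0 i : measurableTypeR R).
Proof.
move=> _ A mA; rewrite setTI; apply: sub_sigma_algebra.
rewrite (bigD1 i)//=; left; exists A => //.
by rewrite setTI.
Qed.

Lemma measurable_fun_rVP d (T : measurableType d) (f : T -> 'rV[R]_n) :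
  (forall i, measurable_fun setT (fun x => f x ord0 i : measurableTypeR R)) ->
  measurable_fun setT f.
Proof.
move=> mf; apply: (@measurability _ _ _ _ _ _
  (\big[setU/set0]_(i < n) preimage_set_system setT (coord i) measurable)) => //.
move=> _ [B + <-]; rewrite setTI.
elim/big_ind: _ => //.
- by move=> X Y hX hY [/hX|/hY].
- move=> i _ [C mC <-]; rewrite setTI.
  by rewrite -[X in measurable X]setTI; exact: mf.
Qed.

Lemma open_measurable_rV (U : set 'rV[R]_n) : open U -> measurable U.
Proof.
move=> oU.
pose box (q : 'rV[rat]_n * nat) : set 'rV[R]_n :=
  \bigcap_(i in [set: 'I_n]) ((fun v => v ord0 i : measurableTypeR R) @^-1`
    (ball (ratr (q.1 ord0 i) : R) (q.2.+1%:R^-1))).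
have mbox q : measurable (box q).
  apply: fin_bigcap_measurable => // i _.
  rewrite -[X in measurable X]setTI; apply: measurable_coord_rV => //.
  exact: measurable_realfun.measurable_ball.
have -> : U = \bigcup_(q in [set: 'rV[rat]_n * nat])
                (if `[< box q `<=` U >] then box q else set0).
  apply/seteqP; split => [x Ux|x [q _]]; last first.
    by case: asboolP => // + bx; exact.
  have /nbhs_ballP[e /= e0 eU] : nbhs x U by exact: open_nbhs_nbhs.
  have [k ke] : exists k : nat, k.+1%:R^-1 < e / 2.
    have e20 : 0 < e / 2 by rewrite divr_gt0.
    have [k _ /(_ k)] := near_infty_natSinv_lt (PosNum e20).
    by move=> /(_ (leqnn _))/=; exists k.
  have /(_ _)/cid qP (i : 'I_n) : exists q : rat,
      `|x ord0 i - ratr q| < k.+1%:R^-1.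
    have k0 : 0 < k.+1%:R^-1 :> R by rewrite invr_gt0.
    have [|q] := @rat_in_itvoo R (x ord0 i - k.+1%:R^-1) (x ord0 i + k.+1%:R^-1).
      by rewrite ltrBlDr -addrA ltrDl addr_gt0.
    rewrite in_itv/= => /andP[q1 q2]; exists q.
    by rewrite distrC ltr_distl q1 q2.
  exists (\row_i sval (qP i), k) => //; rewrite asboolT.
    by move=> i _ /=; rewrite mxE /ball/= distrC; exact: (svalP (qP i)).
  move=> y yb; apply: eU; split => // i j.
  rewrite (ord1 i) /ball/=.
  have := yb j I; rewrite /= mxE /ball/= => yq.
  have xq := svalP (qP j).
  rewrite (splitr e) -(subrKA (ratr (sval (qP j)))).
  rewrite (le_lt_trans (ler_normD _ _))// ltrD//.
    exact: lt_trans xq ke.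
  exact: lt_trans yq ke.
apply: countable_bigcupT_measurable => // q.
by case: asboolP.
Qed.

End measurable_rV.

Section lebesgue_rV.
Context {R : realType}.

Definition consrV n (p : measurableTypeR R * 'rV[R]_n) : 'rV[R]_n.+1 :=
  row_mx (p.1 : R)%:M p.2.

Lemma consrV0 n p : @consrV n p ord0 ord0 = p.1.
Proof.
rewrite (_ : ord0 = lshift n (ord0 : 'I_1)); last exact/val_inj.
by rewrite (@row_mxEl R 1 1 n) mxE mulr1n.
Qed.

Lemma consrV_lift n p j : @consrV n p ord0 (lift ord0 j) = p.2 ord0 j.
Proof.
rewrite (_ : lift ord0 j = rshift 1 j); last exact/val_inj.
by rewrite (@row_mxEr R 1 1 n).
Qed.

Lemma measurable_consrV n : measurable_fun setT (@consrV n).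
Proof.
apply: measurable_fun_rVP => i.
have [->|[j ->]] : i = ord0 \/ exists j, i = lift ord0 j.
  by case: (unliftP ord0 i) => [j ->|->]; [right; exists j|left].
- under eq_fun do rewrite consrV0.
  exact: measurable_fst.
- under eq_fun do rewrite consrV_lift.
  exact: (measurableT_comp (@measurable_coord_rV R n j) measurable_snd).
Qed.

Section step.
Variables (n : nat) (mu : {sigma_finite_measure set 'rV[R]_n -> \bar R}).

Definition lebesgue_rV_succ : set 'rV[R]_n.+1 -> \bar R :=
  pushforward (@lebesgue_measure R \x mu)%E (@consrV n).

Let pushfwd : {measure set 'rV[R]_n.+1 -> \bar R} :=
  @measure_function_pushforward__canonical__measure_function_Measure
    _ _ _ _ _ (lebesgue_measure \x mu)%E _ (@measurable_consrV n).

Let lebesgue_rV_succ0 : lebesgue_rV_succ set0 = 0%E.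
Proof. exact: (@measure0 _ _ _ pushfwd). Qed.

Let lebesgue_rV_succ_ge0 A : (0 <= lebesgue_rV_succ A)%E.
Proof. exact: (@measure_ge0 _ _ _ pushfwd). Qed.

Let lebesgue_rV_succ_sigma_additive : semi_sigma_additive lebesgue_rV_succ.
Proof. exact: (@measure_semi_sigma_additive _ _ _ pushfwd). Qed.

HB.instance Definition _ := isMeasure.Build _ _ _ lebesgue_rV_succ
  lebesgue_rV_succ0 lebesgue_rV_succ_ge0 lebesgue_rV_succ_sigma_additive.

Let lebesgue_rV_succ_sigma_finite : sigma_finite setT lebesgue_rV_succ.
Proof.
have /sigma_finiteP[F [TF ndF Foo]] := sigma_finiteT (@lebesgue_measure R).
have /sigma_finiteP[G [TG ndG Goo]] := sigma_finiteT mu.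
pose g (v : 'rV[R]_n.+1) : measurableTypeR R * 'rV[R]_n :=
  (v ord0 ord0, \row_j v ord0 (lift ord0 j)).
have mg : measurable_fun setT g.
  apply/measurable_fun_pairP; split.
    exact: measurable_coord_rV.
  apply: measurable_fun_rVP => j /=.
  under eq_fun do rewrite mxE.
  exact: measurable_coord_rV.
have gK p : g (consrV p) = p.
  rewrite /g consrV0 [RHS]surjective_pairing; congr pair.
  by apply/rowP => j; rewrite mxE consrV_lift.
exists (fun i => g @^-1` (F i `*` G i)).
  rewrite -preimage_bigcup (_ : \bigcup_i _ = setT) ?preimage_setT//.
  rewrite -subTset => -[x y] _.
  have [i _ Fx] : (\bigcup_i F i) x by rewrite -TF.
  have [j _ Gy] : (\bigcup_i G i) y by rewrite -TG.
  exists (maxn i j) => //; split.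
  - by move: x Fx; exact/subsetPset/ndF/leq_maxl.
  - by move: y Gy; exact/subsetPset/ndG/leq_maxr.
move=> i; have [mF Fi] := Foo i; have [mG Gi] := Goo i; split.
  by rewrite -[X in measurable X]setTI; apply: mg => //; exact: measurableX.
rewrite /lebesgue_rV_succ /pushforward -comp_preimage.
rewrite (_ : g \o _ = id) ?preimage_id; last by apply/funext => p /=; rewrite gK.
by rewrite product_measure1E// lte_mul_pinfty// ge0_fin_numE.
Qed.

HB.instance Definition _ := Measure_isSigmaFinite.Build _ _ _
  lebesgue_rV_succ lebesgue_rV_succ_sigma_finite.

End step.

(* Lebesgue measure on R^n, as the n-fold product of the one-dimensional one;
   R^0 is a single point, of mass 1. *)
Fixpoint lebesgue_rV n : {sigma_finite_measure set 'rV[R]_n -> \bar R} :=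
  match n return {sigma_finite_measure set 'rV[R]_n -> \bar R} with
  | 0 => dirac (0 : 'rV[R]_0)
  | m.+1 => lebesgue_rV_succ (lebesgue_rV m)
  end.

End lebesgue_rV.
Arguments lebesgue_rV R n : clear implicits.

Section euclidean.
Context {R : realType}.

(* The library norm of a row vector is the sup norm. *)
Definition euclidean_norm n (x : 'rV[R]_n) : R :=
  Num.sqrt (\sum_i x ord0 i ^+ 2).

Definition boundary (T : topologicalType) (A : set T) : set T :=
  closure A `\` A°.

(* Near each boundary point, in some orthonormal coordinates x *m Q, the set is
   the strict epigraph of a Lipschitz function g expressing coordinate j in
   terms of the other d.-1 coordinates, col' j. *)
Definition lipschitz_boundary d (A : set 'rV[R]_d) : Prop :=
  forall x0, boundary A x0 ->
  exists r : R, 0 < r /\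
  exists (Q : 'M[R]_d) (j : 'I_d) (g : 'rV[R]_d.-1 -> R^o),
    [/\ Q *m Q^T = 1%:M, lipschitz g &
        forall x, euclidean_norm (x - x0) < r ->
          (A x <-> g (col' j (x *m Q)) < (x *m Q) ord0 j)].

End euclidean.

(* Real L^2(Omega), as the library space of almost-everywhere classes for the
   restriction of Lebesgue measure to Omega; an element coerces to a
   representative defined on the whole of R^d. *)
Definition L2 (R : realType) d (Omega : set 'rV[R]_d) (oO : open Omega) : Type :=
  LspaceType2 (mrestr (lebesgue_rV R d) (open_measurable_rV oO)).

Section functionals.
Context {R : realType} {d : nat} {Omega : set 'rV[R]_d} {oO : open Omega}.
Local Notation mu := (lebesgue_rV R d).
Implicit Types u v : L2 oO.

Definition L2_fun u : 'rV[R]_d -> R := u.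
Coercion L2_fun : L2 >-> Funclass.

Definition L2_weak_cvg (u_ : nat -> L2 oO) u : Prop :=
  forall v, \int[mu]_(x in Omega) (u_ n x * v x) @[n --> \oo]
            --> \int[mu]_(x in Omega) (u x * v x).

(* On the (null) diagonal x = y the quotient is 0, by the conventions
   0 `^ s = 0 for s != 0 and 0^-1 = 0. *)
Definition J (alpha : R) u : R :=
  - \int[mu]_(x in Omega) \int[mu]_(y in Omega)
      (u x * u y / euclidean_norm (x - y) `^ (d%:R - alpha)).

Definition Jd u : R := - (\int[mu]_(x in Omega) u x) ^+ 2.

End functionals.

(* Sequential Gamma-convergence, as a -> d^- in (0, d), of F a to F0, for the
   notion of convergence cvg of sequences of X. *)
Definition gamma_cvg_left (R : realType) (X : Type)
    (cvg : (nat -> X) -> X -> Prop) (d : R) (F : R -> X -> R) (F0 : X -> R) :=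
  forall a_ : nat -> R, (forall n, 0 < a_ n < d) -> a_ @ \oo --> d^'- ->
    (forall (u_ : nat -> X) (u : X), cvg u_ u ->
       ((F0 u)%:E <= limn_einf (fun n => (F (a_ n) (u_ n))%:E))%E) /\
    (forall u : X, exists2 u_ : nat -> X, cvg u_ u &
       F (a_ n) (u_ n) @[n --> \oo] --> F0 u).

(* Main.v *)
From HB Require Import structures.
Require Import Defs.
From mathcomp Require Import all_boot all_order all_algebra.
From mathcomp Require Import all_classical all_reals all_analysis.
From mathcomp Require Import measurable_realfun ring lra.

(** Write s = d - alpha, a positive number tending to 0, and split the kernel
    as |x - y|^(-s) = 1 + (|x - y|^(-s) - 1).  The constant 1 contributes
    exactly the squared mean, so

      J^alpha (u) - J^d (u) = - \int \int u(x) u(y) (|x - y|^(-s) - 1) dy dx.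

    By the Schur test (schur_test) the right-hand side is at most
    eta(s) * ||u||_2^2, where eta(s) bounds \int_Omega ||x - y|^(-s) - 1| dy
    uniformly in x in Omega.  Since Omega is bounded and the singularity
    |z|^(-s) is integrable uniformly for s near 0, eta(s) tends to 0
    (norm_inv_powR_sub1_le, integral_kernel_le, kernel_modulus_cvg0).

    A weakly convergent sequence is bounded in L^2, by the uniform boundedness
    principle (Lfun2_uniform_boundedness); it is proved by a gliding hump, which
    only requires constructing one function of L^2 as an almost everywhere
    convergent series (gliding_hump).  Hence
    J^alpha_n (u_n) - J^d (u_n) tends to 0, and J^d (u_n) tends to J^d (u)
    because u |-> \int u is tested against the constant function 1, which
    belongs to L^2 of the bounded set Omega.

    So both J and - J converge continuously along weakly convergent sequences,
    and continuous convergence gives Gamma-convergence with constant recovery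
    sequences (gamma_cvg_left_of_cvg). *)

Set Implicit Arguments.
Unset Strict Implicit.
Unset Printing Implicit Defensive.

Import Order.TTheory GRing.Theory Num.Theory.
Import numFieldNormedType.Exports.

Local Open Scope classical_set_scope.
Local Open Scope ring_scope.

(** * Square-integrable functions *)

Section square_integrable.
Context {d} {T : measurableType d} {R : realType}.
Variable nu : {measure set T -> \bar R}.

Lemma Lfun2_measurable (f : T -> R) :
  f \in Lfun nu 2%:E -> measurable_fun setT f.
Proof. by move=> /sub_Lfun_mfun; rewrite inE. Qed.

Lemma Lfun2_of_sqr (f : T -> R) : measurable_fun setT f ->
  (\int[nu]_x (f x ^+ 2)%:E < +oo)%E -> f \in Lfun nu 2%:E.
Proof.
move=> mf foo; rewrite inE; apply/andP; split; rewrite inE//=.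
rewrite /finite_norm unlock/= poweR_lty//.
under eq_integral do rewrite powR_mulrn// -normrX ger0_norm ?sqr_ge0//.
exact: foo.
Qed.

Lemma integrable_Lfun2M (f g : T -> R) :
  f \in Lfun nu 2%:E -> g \in Lfun nu 2%:E ->
  nu.-integrable setT (EFin \o (fun x => f x * g x)).
Proof. by move=> hf hg; apply/Lfun1_integrable; exact: Lfun2_mul_Lfun1. Qed.

Lemma Lfun2Z (a : R) (f : T -> R) :
  f \in Lfun nu 2%:E -> (fun x => a * f x) \in Lfun nu 2%:E.
Proof.
move=> hf; have := @Lfun_scale _ _ _ nu f a 2 (ler1n _ 2) hf.
by rewrite (_ : (fun x => _) = a \o* f)//; apply/funext => x /=; rewrite mulrC.
Qed.

Lemma Lfun2D (f g : T -> R) : f \in Lfun nu 2%:E -> g \in Lfun nu 2%:E ->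
  (fun x => f x + g x) \in Lfun nu 2%:E.
Proof.
move=> hf hg; have [_ /(_ 1 f g hf hg)] := @Lfun_submod_closed _ _ _ nu _ (lee1n 2).
by rewrite scale1r.
Qed.

(** A form of the Cauchy-Schwarz inequality that avoids square roots: for
    functions of norm 1 it gives the same bound. *)
Lemma norm_Rintegral_mul_le (f g : T -> R) :
  f \in Lfun nu 2%:E -> g \in Lfun nu 2%:E ->
  `|\int[nu]_x (f x * g x)| <=
    (\int[nu]_x (f x ^+ 2) + \int[nu]_x (g x ^+ 2)) / 2.
Proof.
move=> hf hg.
have if2 := Lfun2_integrable_sqr hf.
have ig2 := Lfun2_integrable_sqr hg.
have ifg := integrable_Lfun2M hf hg.
apply: (le_trans (le_normr_Rintegral _ ifg)) => //.
rewrite -RintegralD// -RintegralZr//; last exact: (integrableD _ if2 ig2).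
apply: le_Rintegral => //.
- exact: (integrable_norm ifg).
- exact: (integrableZr measurableT 2^-1 (integrableD measurableT if2 ig2)).
- move=> x _; rewrite normrM.
  rewrite -[f x ^+ 2]real_normK ?num_real// -[g x ^+ 2]real_normK ?num_real//.
  have := sqr_ge0 (`|f x| - `|g x|); lra.
Qed.

End square_integrable.

(** * Uniform boundedness in L^2 *)

Section nonneg_series.
Context {R : realType}.

Lemma nneseries_EFin_le (a : nat -> R) (C : R) :
  (forall k, 0 <= a k) -> (forall n, \sum_(0 <= k < n) a k <= C) ->
  (\sum_(0 <= k <oo) (a k)%:E <= C%:E)%E.
Proof.
move=> a0 aC; apply: lime_le.
  by apply: is_cvg_nneseries => n _ _; rewrite lee_fin.
by apply: nearW => n /=; rewrite sumEFin lee_fin.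
Qed.

Lemma sum_expr_le (x : R) n : 0 < x < 1 ->
  \sum_(0 <= k < n) x ^+ k <= (1 - x)^-1.
Proof.
move=> /andP[x0 x1]; rewrite -[leRHS]mul1r.
have := @geometric_le_lim R n 1 x ler01 x0; rewrite ger0_norm ?(ltW x0)// => /(_ x1).
by apply: le_trans; rewrite /series/=; apply: ler_sum => i _; rewrite mul1r.
Qed.

End nonneg_series.

Section hump.
Context {d} {T : measurableType d} {R : realType}.
Variable nu : {measure set T -> \bar R}.
Variable e : nat -> T -> R.
Hypothesis e2 : forall k, e k \in Lfun nu 2%:E.
Hypothesis e1 : forall k, \int[nu]_x (e k x ^+ 2) = 1.

Let c (k : nat) : R := 3^-1 ^+ k.
Let c_gt0 k : 0 < c k. Proof. by rewrite exprn_gt0// invr_gt0. Qed.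
Let cS k : c k.+1 = c k / 3. Proof. by rewrite /c exprSr. Qed.

Let sgn (r : R) : R := if 0 <= r then 1 else -1.
Let norm_sgn r : `|sgn r| = 1.
Proof. by rewrite /sgn; case: ifP; rewrite ?normrN1 ?normr1. Qed.

(** Partial sums of a series of the 3^-m e_m with signs: the sign of each
    summand is chosen so that, tested against e_m, it does not cancel against
    the previous partial sum. *)
Fixpoint hump (n : nat) : T -> R :=
  if n is m.+1
  then fun t => hump m t + sgn (\int[nu]_x (e m x * hump m x)) * c m * e m t
  else fun=> 0.

Let hump2 n : hump n \in Lfun nu 2%:E.
Proof.
elim: n => [|n ih] /=; last by apply: Lfun2D => //; exact: Lfun2Z.
by have [] := @Lfun_submod_closed _ _ _ nu _ (lee1n 2).
Qed.

Let hump_testS k n : \int[nu]_x (e k x * hump n.+1 x) =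
  \int[nu]_x (e k x * hump n x) +
  sgn (\int[nu]_x (e n x * hump n x)) * c n * \int[nu]_x (e k x * e n x).
Proof.
rewrite -RintegralZl//; last exact: integrable_Lfun2M.
rewrite -RintegralD//; last 2 first.
- exact: integrable_Lfun2M.
- exact: (integrableZl measurableT _ (integrable_Lfun2M (e2 k) (e2 n))).
by apply: eq_Rintegral => x _ /=; ring.
Qed.

(* The ratio 3 leaves room: once step k has secured the value c k, the later
   steps take away at most half of it, since the tail of c is c k / 2.  The
   extra c (k + m) / 2 is what makes the induction go through. *)
Let hump_test k m :
  (c k + c (k + m)) / 2 <= `|\int[nu]_x (e k x * hump (k + m).+1 x)|.
Proof.
elim: m => [|m ih].
  rewrite addn0 hump_testS.
  have -> : \int[nu]_x (e k x * e k x) = 1 by rewrite -(e1 k).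
  rewrite mulr1 /sgn; case: ifPn => [h|]; last rewrite -ltNge => h.
    by rewrite mul1r ger0_norm; have := c_gt0 k; lra.
  by rewrite mulN1r ltr0_norm; have := c_gt0 k; lra.
rewrite addnS hump_testS.
set s := sgn _; set I := \int[nu]_x (e k x * e _ x).
have I1 : `|I| <= 1.
  apply: (le_trans (norm_Rintegral_mul_le (e2 k) (e2 _))).
  by rewrite !e1; lra.
have : `|s * c (k + m).+1 * I| <= c (k + m) / 3.
  by rewrite !normrM norm_sgn mul1r -cS gtr0_norm// ler_piMr// ltW.
have := c_gt0 (k + m); have := cS (k + m).
set P := \int[nu]_x (e k x * hump _ x) in ih *.
have := lerB_normD P (s * c (k + m).+1 * I).
lra.
Qed.

Let W n : R := \sum_(0 <= i < n) c i.
Let Q n t : R := \sum_(0 <= i < n) c i * e i t ^+ 2.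

(* Jensen's inequality for the weights c i, by induction. *)
Let hump_sqr n t : hump n t ^+ 2 <= W n * Q n t.
Proof.
have W0 m : 0 <= W m by apply: sumr_ge0 => i _; exact: ltW.
have Q0 m : 0 <= Q m t by apply: sumr_ge0 => i _; rewrite mulr_ge0 ?sqr_ge0 ?ltW.
elim: n => [|n ih] /=; first by rewrite expr0n/= mulr_ge0.
rewrite /W /Q !big_nat_recr//= -/(W n) -/(Q n t).
set s := sgn _; set a := e n t; set S := hump n t in ih *.
have s2 : s ^+ 2 = 1 by rewrite -real_normK ?num_real// norm_sgn expr1n.
have key : 2 * S * (s * a) <= W n * a ^+ 2 + Q n t.
  have [W00|Wn0] := eqVneq (W n) 0.
    have -> : S = 0.
      by apply/eqP; rewrite -sqrf_eq0 eq_le sqr_ge0 andbT (le_trans ih)// W00 mul0r.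
    by rewrite mulr0 mul0r W00 mul0r add0r.
  have Wp : 0 < W n by rewrite lt_def Wn0 W0.
  rewrite -(ler_pM2l Wp).
  have := sqr_ge0 (W n * (s * a) - S).
  have -> : (W n * (s * a) - S) ^+ 2 =
    W n ^+ 2 * (s ^+ 2 * a ^+ 2) - 2 * W n * S * (s * a) + S ^+ 2 by ring.
  rewrite s2 mul1r; move: ih; lra.
have cn := c_gt0 n.
have -> : (S + s * c n * a) ^+ 2 =
  S ^+ 2 + c n * (2 * S * (s * a)) + s ^+ 2 * (c n ^+ 2 * a ^+ 2) by ring.
rewrite s2 mul1r.
have : c n * (2 * S * (s * a)) <= c n * (W n * a ^+ 2 + Q n t) by rewrite ler_pM2l.
move: ih; lra.
Qed.

(* The integrable majorant: it controls the squares of the partial sums, and the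
   series converges wherever it is finite. *)
Let H t : \bar R := \sum_(0 <= k <oo) (c k * e k t ^+ 2)%:E.

Let term_ge0 k t : (0 <= (c k * e k t ^+ 2)%:E)%E.
Proof. by rewrite lee_fin mulr_ge0 ?sqr_ge0// ltW. Qed.

Let mterm k : measurable_fun setT (fun t => (c k * e k t ^+ 2)%:E).
Proof.
apply/measurable_EFinP/measurable_funM => //.
exact/measurable_funX/(Lfun2_measurable (e2 k)).
Qed.

Let measurable_H : measurable_fun setT H.
Proof. exact: ge0_emeasurable_sum. Qed.

Let H_ge0 t : (0 <= H t)%E. Proof. exact: nneseries_ge0. Qed.

Let W_le n : W n <= 2.
Proof.
have h3 : 0 < (3^-1 : R) < 1 by apply/andP; split; lra.
apply: (le_trans (sum_expr_le n h3)).
by have -> : (1 - 3^-1)^-1 = 3 / 2 :> R by [field]; lra.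
Qed.

Let Q_le_H n t : ((Q n t)%:E <= H t)%E.
Proof. by rewrite /Q -sumEFin; exact: nneseries_lim_ge. Qed.

Let integrable_H : nu.-integrable setT H.
Proof.
apply/integrableP; split => //.
under eq_integral do rewrite gee0_abs//.
rewrite integral_nneseries//.
under eq_eseriesr => k _.
  under eq_integral do rewrite EFinM.
  rewrite ge0_integralZl//=; last 3 first.
  - by apply/measurable_EFinP/measurable_funX/(Lfun2_measurable (e2 k)).
  - by move=> x _; rewrite lee_fin sqr_ge0.
  - by rewrite lee_fin ltW.
  have -> : (\int[nu]_x (e k x ^+ 2)%:E = 1)%E.
    rewrite -[LHS]fineK; last exact/(integrable_fin_num measurableT)/Lfun2_integrable_sqr.
    by congr EFin; exact: e1.
  rewrite mule1; over.
apply: (@le_lt_trans _ _ 2%:E); last by rewrite ltry.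
exact: nneseries_EFin_le (fun k => ltW (c_gt0 k)) W_le.
Qed.

Let sqr_hump_le_H n t : ((hump n t ^+ 2)%:E <= 2%:E * H t)%E.
Proof.
apply: (@le_trans _ _ (2 * Q n t)%:E); last by rewrite EFinM lee_pmul2l.
rewrite lee_fin (le_trans (hump_sqr n t))// ler_wpM2r//.
by apply: sumr_ge0 => i _; rewrite mulr_ge0 ?sqr_ge0 ?ltW.
Qed.

(* An upper limit is measurable without any convergence, and agrees with the
   limit almost everywhere. *)
Let v t : R := fine (limn_esup (fun n => (hump n t)%:E)).

Let measurable_v : measurable_fun setT v.
Proof.
apply: (measurableT_comp (@fine_measurable R setT measurableT)).
by apply: measurable_fun_limn_esup => n; exact/measurable_EFinP/Lfun2_measurable.
Qed.

Let cvg_hump t : H t \is a fin_num -> hump n t @[n --> \oo] --> v t.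
Proof.
move=> Ht.
pose a m := sgn (\int[nu]_x (e m x * hump m x)) * c m * e m t.
have humpE : hump ^~ t = series a.
  apply/funext => n; rewrite /series/=.
  elim: n => [|n ih]; first by rewrite big_geq.
  by rewrite big_nat_recr//= -ih.
have cv : cvgn (series a).
  apply: (@normed_cvg R R^o); apply: nondecreasing_is_cvgn.
    by apply: nondecreasing_series => n _ _; exact: normr_ge0.
  exists (2 + fine (H t)) => _ [n _ <-].
  apply: (@le_trans _ _ (W n + Q n t)); last first.
    by apply: lerD => //; rewrite -lee_fin fineK.
  (* |e_i| <= 1 + e_i^2, so that the series is absolutely dominated. *)
  rewrite /series/= /W /Q -big_split/=; apply: ler_sum => i _.
  rewrite /a !normrM norm_sgn mul1r (gtr0_norm (c_gt0 i)) -{2}(mulr1 (c i)) -mulrDr.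
  rewrite ler_wpM2l ?(ltW (c_gt0 i))// -[e i t ^+ 2]real_normK ?num_real//.
  have := sqr_ge0 (`|e i t| - 1); have := normr_ge0 (e i t); nra.
have cve : (hump n t)%:E @[n --> \oo] --> (limn (series a))%:E.
  by rewrite -/(EFin \o hump ^~ t) humpE; apply: cvg_EFin => //; apply: nearW.
rewrite /v (cvg_limn_einf_sup cve).2/=.
by rewrite humpE.
Qed.

Let ae_H : {ae nu, forall t, H t \is a fin_num}.
Proof. by apply: filterS (integrable_ae measurableT integrable_H) => t /(_ I). Qed.

Let v2 : v \in Lfun nu 2%:E.
Proof.
apply: Lfun2_of_sqr => //.
apply: (@le_lt_trans _ _ (\int[nu]_x (2%:E * H x))%E); last first.
  by apply: integrable_lty => //; exact: integrableZl.
apply: ae_ge0_le_integral => //.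
- by move=> x _; rewrite lee_fin sqr_ge0.
- exact/measurable_EFinP/measurable_funX.
- by move=> x _; rewrite mule_ge0.
- exact/measurable_funeM.
apply: filterS ae_H => t Ht _.
have cv2 : (hump n t ^+ 2)%:E @[n --> \oo] --> (v t ^+ 2)%:E.
  by apply: cvg_EFin; [exact: nearW|exact: cvgM (cvg_hump Ht) (cvg_hump Ht)].
rewrite -(cvg_lim _ cv2)//; apply: lime_le; first by apply/cvg_ex; eexists; exact: cv2.
exact: nearW.
Qed.

(** A single function v that pairs with every unit vector e k to at least
    3^-k / 2 in absolute value: the pairings with the partial sums satisfy this
    by hump_test, and pass to the limit by dominated convergence, with
    dominating function e_k^2 + 2 H. *)
Lemma gliding_hump : exists2 v, v \in Lfun nu 2%:E &
  forall k, 3^-1 ^+ k / 2 <= `|\int[nu]_x (e k x * v x)|.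
Proof.
exists v => // k.
have [_ _ cvI] : [/\ nu.-integrable setT (fun x => (e k x * v x)%:E),
    [sequence \int[nu]_x `|(e k x * hump n x)%:E - (e k x * v x)%:E|]_n @ \oo --> 0
  & [sequence \int[nu]_x (e k x * hump n x)%:E]_n @ \oo
      --> \int[nu]_x (e k x * v x)%:E]%E.
  apply: (@dominated_convergence _ _ _ nu setT measurableT
    (fun n x => (e k x * hump n x)%:E) _ (fun x => (e k x ^+ 2)%:E + 2%:E * H x)%E).
  - move=> n; apply/measurable_EFinP/measurable_funM; exact: Lfun2_measurable.
  - by apply/measurable_EFinP/measurable_funM => //; exact: Lfun2_measurable.
  - apply: filterS ae_H => t Ht _; apply: cvg_EFin; first exact: nearW.
    by apply: cvgZl_tmp; exact: cvg_hump.
  - apply: integrableD => //; first exact/Lfun2_integrable_sqr.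
    exact: integrableZl.
  - apply: nearW => t n _.
    apply: (@le_trans _ _ ((e k t ^+ 2)%:E + (hump n t ^+ 2)%:E)%E); last exact: leeD.
    rewrite -EFinD lee_fin normrM.
    rewrite -[e k t ^+ 2]real_normK ?num_real// -[hump n t ^+ 2]real_normK ?num_real//.
    have := sqr_ge0 (`|e k t| - `|hump n t|).
    have := sqr_ge0 `|e k t|; have := sqr_ge0 `|hump n t|; lra.
have cvR : \int[nu]_x (e k x * hump n x) @[n --> \oo] --> \int[nu]_x (e k x * v x).
  apply: fine_cvg; rewrite fineK//.
  exact/(integrable_fin_num measurableT)/(integrable_Lfun2M (e2 k) v2).
have cvN : `|\int[nu]_x (e k x * hump n x)| @[n --> \oo]
    --> `|\int[nu]_x (e k x * v x)| by exact: cvg_norm.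
rewrite -(cvg_lim (@Rhausdorff R) cvN); apply: limr_ge.
  by apply/cvg_ex; eexists; exact: cvN.
near=> n.
have kn : (k < n)%N by near: n; exists k.+1.
have nE : n = (k + (n.-1 - k)).+1.
  by rewrite subnKC -1?ltnS ?prednK// (leq_ltn_trans _ kn).
rewrite nE; apply: le_trans (hump_test _ _).
by rewrite ler_wpM2r ?invr_ge0// lerDl ltW.
Unshelve. all: by end_near. Qed.

End hump.

Lemma exists_expr_gt (R : realType) (x A : R) : 1 < x -> exists n, A < x ^+ n.
Proof.
move=> x1; exists (Num.Def.truncn (A / (x - 1))).+1.
have bernoulli n : n%:R * (x - 1) <= x ^+ n.
  apply: (@le_trans _ _ (1 + n%:R * (x - 1))); first by rewrite lerDr.
  elim: n => [|n ih]; first by rewrite expr0 mul0r addr0.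
  rewrite exprS -natr1.
  have : 0 <= n%:R * (x - 1) ^+ 2 by rewrite mulr_ge0 ?sqr_ge0.
  have : x * (1 + n%:R * (x - 1)) <= x * x ^+ n by rewrite ler_pM2l//; lra.
  lra.
apply: lt_le_trans (bernoulli _); rewrite -ltr_pdivrMr ?subr_gt0//.
exact: truncnS_gt.
Qed.

Section uniform_boundedness.
Context {d} {T : measurableType d} {R : realType}.
Variable nu : {measure set T -> \bar R}.

(** The uniform boundedness principle for the functionals v |-> \int u_n v.  If
    the norms were unbounded, a subsequence would satisfy
    ||u_(f k)||_2 >= 4^k; the function v given by gliding_hump for its
    normalizations then has |\int u_(f k) v| >= (4/3)^k / 2, which is
    unbounded. *)
Lemma Lfun2_uniform_boundedness (u : nat -> T -> R) :
  (forall n, u n \in Lfun nu 2%:E) ->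
  (forall v, v \in Lfun nu 2%:E ->
     exists C : R, forall n, `|\int[nu]_x (u n x * v x)| <= C) ->
  exists C : R, forall n, \int[nu]_x (u n x ^+ 2) <= C.
Proof.
move=> u2 ub; apply: contrapT => /forallNP unb.
have /choice[f fP] : forall k, exists n, 16 ^+ k < \int[nu]_x (u n x ^+ 2).
  by move=> k; have /existsNP[n /negP] := unb (16 ^+ k); rewrite -ltNge; exists n.
have I0 k : 0 < \int[nu]_x (u (f k) x ^+ 2).
  by apply: le_lt_trans (fP k); rewrite exprn_ge0.
pose N k := Num.sqrt (\int[nu]_x (u (f k) x ^+ 2)).
have N4 k : 4 ^+ k <= N k.
  rewrite -(@ler_pXn2r _ 2)// ?nnegrE ?sqrtr_ge0 ?exprn_ge0//.
  rewrite sqr_sqrtr ?(ltW (I0 k))//.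
  have -> : (4 ^+ k) ^+ 2 = 16 ^+ k :> R by rewrite exprAC; congr (_ ^+ k); ring.
  exact/ltW/fP.
have N0 k : 0 < N k by apply: lt_le_trans (N4 k); rewrite exprn_gt0.
pose e k x := (N k)^-1 * u (f k) x.
have e2 k : e k \in Lfun nu 2%:E by exact: Lfun2Z.
have e1 k : \int[nu]_x (e k x ^+ 2) = 1.
  under eq_Rintegral do rewrite exprMn.
  rewrite RintegralZl//; last exact: Lfun2_integrable_sqr.
  rewrite exprVn sqr_sqrtr ?(ltW (I0 k))// mulVf//.
  by rewrite gt_eqF.
have [v v2 ev] := gliding_hump e2 e1.
have [C uC] := ub v v2.
have bnd k : (4 / 3) ^+ k <= 2 * C.
  have := ev k.
  under eq_Rintegral do rewrite -mulrA.
  rewrite RintegralZl//; last exact: integrable_Lfun2M.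
  rewrite normrM gtr0_norm ?invr_gt0// => h.
  have : 3^-1 ^+ k / 2 <= (4 ^+ k)^-1 * C.
    apply: (le_trans h); apply: ler_pM; rewrite ?invr_ge0 ?(ltW (N0 k))//.
    by rewrite lef_pV2 ?posrE ?exprn_gt0.
  have k4 : 0 < (4 : R) ^+ k by rewrite exprn_gt0.
  rewrite -(ler_pM2l k4) mulVKf ?gt_eqF//.
  rewrite mulrA -exprMn; lra.
have [k] := @exists_expr_gt R (4 / 3) (2 * C) ltac:(lra).
by rewrite ltNge bnd.
Qed.

End uniform_boundedness.

(** * The Schur test *)

Section Rintegral_fubini.
Context {d} {T : measurableType d} {R : realType}.
Variable nu : {sigma_finite_measure set T -> \bar R}.

(** The inner real-valued integral agrees with the extended one only where it is
    finite, which is almost everywhere. *)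
Lemma Rintegral_prod (F : T * T -> R) :
  (nu \x nu)%E.-integrable setT (EFin \o F) ->
  \int[nu]_x \int[nu]_y F (x, y) = \int[(nu \x nu)%E]_z F z.
Proof.
move=> iF; rewrite /Rintegral -(integral12_prod_meas1 iF).
congr fine; apply: ae_eq_integral => //.
- apply/measurable_EFinP/(measurableT_comp (@fine_measurable R setT measurableT)).
  exact: (measurable_fubini_F iF).
- exact: (measurable_fubini_F iF).
- apply: filterS (ae_integrable1 iF) => x ix _ /=.
  by rewrite fineK//; exact: integrable_fin_num.
Qed.

(** The bound |u(x) u(y) k| <= (u(x)^2 + u(y)^2) |k| / 2 reduces the double
    integral to two integrals of the form \int u(x)^2 \int |k(x, y)| dy dx,
    which are equal by the symmetry of k. *)
Lemma schur_test (k : T * T -> R) (eta : R) (u : T -> R) :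
  measurable_fun setT k -> (forall x y, k (x, y) = k (y, x)) ->
  0 <= eta -> {ae nu, forall x, (\int[nu]_y `|k (x, y)|%:E <= eta%:E)%E} ->
  u \in Lfun nu 2%:E ->
  let F z := u z.1 * u z.2 * k z in
  (nu \x nu)%E.-integrable setT (EFin \o F) /\
  `|\int[(nu \x nu)%E]_z F z| <= eta * \int[nu]_x (u x ^+ 2).
Proof.
move=> mk ksym eta0 keta u2 F.
have mu := Lfun2_measurable u2.
have mu1 : measurable_fun setT (fun z : T * T => u z.1).
  exact: (measurableT_comp mu measurable_fst).
have mu2 : measurable_fun setT (fun z : T * T => u z.2).
  exact: (measurableT_comp mu measurable_snd).
have mF : measurable_fun setT F by apply: measurable_funM => //; exact: measurable_funM.
have mnk : measurable_fun setT (fun z => `|k z|) by exact: measurableT_comp.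
pose G1 z := (u z.1 ^+ 2 * `|k z|)%:E; pose G2 z := (u z.2 ^+ 2 * `|k z|)%:E.
have mG1 : measurable_fun setT G1.
  by apply/measurable_EFinP/measurable_funM => //; exact: measurable_funX.
have mG2 : measurable_fun setT G2.
  by apply/measurable_EFinP/measurable_funM => //; exact: measurable_funX.
have G10 z : (0 <= G1 z)%E by rewrite lee_fin mulr_ge0 ?sqr_ge0.
have G20 z : (0 <= G2 z)%E by rewrite lee_fin mulr_ge0 ?sqr_ge0.
have iu2 := Lfun2_integrable_sqr u2.
have inner x : (\int[nu]_y G1 (x, y) = (u x ^+ 2)%:E * \int[nu]_y `|k (x, y)|%:E)%E.
  under eq_integral do rewrite /G1/= EFinM.
  rewrite ge0_integralZl//; last by rewrite lee_fin sqr_ge0.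
  by apply/measurable_EFinP/(measurableT_comp mnk)/pair1_measurable.
have G1le : (\int[nu \x nu]_z G1 z <= (eta * \int[nu]_x (u x ^+ 2))%:E)%E.
  rewrite (fubini_tonelli1 G1)//.
  apply: (@le_trans _ _ (\int[nu]_x (eta * u x ^+ 2)%:E)%E).
    apply: ae_ge0_le_integral => //.
    - by move=> x _; exact: integral_ge0.
    - exact: measurable_fun_fubini_tonelli_F.
    - by move=> x _; rewrite lee_fin mulr_ge0 ?sqr_ge0.
    - by apply/measurable_EFinP/measurable_funM => //; exact: measurable_funX.
    - apply: filterS keta => x kx _; rewrite /fubini_F inner mulrC [leRHS]EFinM.
      by apply: lee_wpmul2l; rewrite ?lee_fin ?sqr_ge0.
  rewrite -RintegralZl// /Rintegral fineK//.
  exact/(integrable_fin_num measurableT)/(integrableZl measurableT eta iu2).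
have G2E : (\int[nu \x nu]_z G2 z = \int[nu \x nu]_z G1 z)%E.
  rewrite (fubini_tonelli2 G2)// (fubini_tonelli1 G1)//.
  apply: eq_integral => y _; apply: eq_integral => x _.
  by rewrite /G1 /G2 ksym.
have Fle : (\int[nu \x nu]_z `|(F z)%:E| <= (eta * \int[nu]_x (u x ^+ 2))%:E)%E.
  apply: (@le_trans _ _ (\int[nu \x nu]_z (2^-1%:E * (G1 z + G2 z)))%E).
    apply: ge0_le_integral => //.
    - by apply: measurableT_comp => //; exact/measurable_EFinP.
    - by apply: measurable_funeM; exact: emeasurable_funD.
    - move=> z _; rewrite -EFinD -EFinM lee_fin /F !normrM -mulrDl mulrA.
      rewrite ler_wpM2r//.
      rewrite -[u z.1 ^+ 2]real_normK ?num_real// -[u z.2 ^+ 2]real_normK ?num_real//.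
      have := sqr_ge0 (`|u z.1| - `|u z.2|); lra.
  rewrite ge0_integralZl//; last 2 first.
  - exact: emeasurable_funD.
  - by move=> z _; rewrite adde_ge0.
  rewrite ge0_integralD// G2E.
  apply: (@le_trans _ _ (2^-1%:E * ((eta * \int[nu]_x u x ^+ 2)%:E + (eta * \int[nu]_x u x ^+ 2)%:E))%E).
    by rewrite lee_pmul2l//; apply: leeD.
  by rewrite -EFinD -EFinM lee_fin; lra.
have iF : (nu \x nu)%E.-integrable setT (EFin \o F).
  apply/integrableP; split; first exact/measurable_EFinP.
  by apply: (le_lt_trans Fle); rewrite ltry.
split => //.
rewrite -lee_fin; apply: le_trans Fle.
by rewrite EFin_normr_Rintegral//; apply: le_abse_integral => //; exact/measurable_EFinP.
Qed.

End Rintegral_fubini.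

(** * The singular kernel near exponent zero *)

Section singular_kernel.
Context {R : realType}.

Lemma powR2_gt1 (r : R) : 0 < r -> 1 < 2 `^ r.
Proof.
move=> r0; have : 1 `^ r < 2 `^ r; last by rewrite powR1.
by apply: gt0_ltr_powR; rewrite ?nnegrE//; lra.
Qed.

Lemma powR2_lt2 (r : R) : 0 < r < 1 -> 2 `^ r < 2.
Proof.
move=> /andP[r0 r1].
have r'1 : 1 < 2 `^ (1 - r) :> R by apply: powR2_gt1; rewrite subr_gt0.
have qq : 2 `^ r * 2 `^ (1 - r) = 2.
  by rewrite -powRD ?pnatr_eq0 ?implybT// addrC subrK powRr1.
by rewrite -[ltRHS]qq ltr_pMr// powR_gt0.
Qed.

(** A dyadic majorant of |e^(-s) - 1|.  The sum telescopes to q^N - 1 with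
    q = 2^s; for 0 < e < 1 one takes the first N with 2^-N < e, so that every
    indicator below N equals 1 and e^(-s) <= q^N.  For e >= 1 the first term is
    enough.  The indicators test a coordinate z of the vector of length e, hence
    slabs rather than balls.  At e = 0 the left-hand side is 1, because of the
    convention that the inverse of 0 is 0, and N is chosen with q^N >= 2. *)
Lemma norm_inv_powR_sub1_le (s D e z : R) : 0 < s -> 1 <= D -> `|z| <= e <= D ->
  exists N, `|(e `^ s)^-1 - 1| <= 1 - (D `^ s)^-1 +
    \sum_(0 <= k < N) ((2 `^ s) ^+ k * (2 `^ s - 1)) * ((`|z| <= 2^-1 ^+ k)%R)%:R.
Proof.
have one_powR r : 1 `^ r = 1 :> R by rewrite powR1.
move=> s0 D1 /andP[ze eD]; set q := 2 `^ s.
have q1 : 1 < q by exact: powR2_gt1.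
have geom N : \sum_(0 <= k < N) q ^+ k * (q - 1) = q ^+ N - 1.
  elim: N => [|N ih]; first by rewrite big_geq// expr0 subrr.
  by rewrite big_nat_recr//= ih exprS; ring.
have D0 : 0 < D by lra.
have DP : 0 <= 1 - (D `^ s)^-1.
  rewrite subr_ge0 invf_le1 ?powR_gt0//.
  by rewrite -[leLHS](one_powR s) ge0_ler_powR ?nnegrE// ltW.
have e0 : 0 <= e by apply: le_trans ze.
have [en|ep] := eqVneq e 0.
  have z0 : `|z| = 0 by apply/eqP; rewrite eq_le normr_ge0 -en ze.
  have [N qN] := exists_expr_gt 2 q1.
  exists N; rewrite z0 en powR0 ?gt_eqF// invr0 sub0r normrN1.
  under eq_bigr do rewrite exprn_ge0 ?invr_ge0// mulr1.
  rewrite geom; lra.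
have {ep} e_gt0 : 0 < e by rewrite lt_def ep.
have [e1|e1] := leP 1 e.
  exists 0%N; rewrite big_geq// addr0 ler0_norm.
    rewrite opprB lerD2l lerN2 lef_pV2 ?posrE ?powR_gt0//.
    by rewrite ge0_ler_powR ?nnegrE// ltW.
  rewrite subr_le0 invf_le1 ?powR_gt0//.
  by rewrite -[leLHS](one_powR s) ge0_ler_powR ?nnegrE// ltW.
have exN : exists N, 2^-1 ^+ N < e.
  have [N eN] := @exists_expr_gt R 2 e^-1 ltac:(lra).
  by exists N; rewrite exprVn -[ltRHS]invrK ltf_pV2 ?posrE ?invr_gt0 ?exprn_gt0.
case: (ex_minnP exN) => N eN minN.
exists N; rewrite ger0_norm; last first.
  rewrite subr_ge0 invf_ge1 ?powR_gt0//.
  by rewrite -[leRHS](one_powR s) ge0_ler_powR ?nnegrE// ltW.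
have -> : \sum_(0 <= k < N) q ^+ k * (q - 1) * ((`|z| <= 2^-1 ^+ k)%R)%:R = q ^+ N - 1.
  rewrite -geom; apply: eq_big_nat => k /andP[_ kN].
  rewrite (le_trans ze) ?mulr1// leNgt; apply/negP => ke.
  by have := minN _ ke; rewrite leqNgt kN.
suff : (e `^ s)^-1 <= q ^+ N by lra.
rewrite -[leRHS]invrK lef_pV2 ?posrE ?powR_gt0 ?invr_gt0 ?exprn_gt0 ?powR_gt0//.
have -> : (q ^+ N)^-1 = (2^-1 ^+ N) `^ s.
  have -> : 2^-1 ^+ N = 2 `^ (- N%:R) :> R by rewrite powRN powR_mulrn// exprVn.
  by rewrite -(@powR_mulrn _ q) ?powR_ge0// /q -!powRrM -powRN mulNr mulrC.
by rewrite ge0_ler_powR ?nnegrE ?exprn_ge0 ?invr_ge0// ltW.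
Qed.

End singular_kernel.

Section singular_integral.
Context {d} {T : measurableType d} {R : realType}.
Variable nu : {finite_measure set T -> \bar R}.
Variables (p : T -> R) (C D : R).
Hypothesis mp : measurable_fun setT p.
Hypothesis C0 : 0 <= C.
Hypothesis D1 : 1 <= D.
Hypothesis slab : forall a r : R, 0 <= r ->
  (nu [set y | (`|a - p y| <= r)%R] <= (C * r)%:E)%E.

(** The integral of the dyadic majorant, when the slab of half-width r has measure
    at most C r: the second term is the sum of the geometric series
    \sum_k q^k (q - 1) * C 2^-k with q = 2^s. *)
Definition kernel_modulus (s : R) : R :=
  (1 - (D `^ s)^-1) * fine (nu setT) + C * (2 `^ s - 1) / (1 - 2 `^ s / 2).

Let inv_powR_le1 (s : R) : 0 <= s -> 0 <= 1 - (D `^ s)^-1.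
Proof.
move=> s0; have -> : 1 = D `^ 0 :> R by rewrite powRr0.
by rewrite subr_ge0 -powRN; apply: ler_powR; rewrite // oppr_le0.
Qed.

Lemma kernel_modulus_ge0 (s : R) : 0 < s < 1 -> 0 <= kernel_modulus s.
Proof.
move=> s01; have /andP[s0 s1] := s01.
have q1 : 1 < 2 `^ s by exact: powR2_gt1.
have q2 : 2 `^ s < 2 by exact: powR2_lt2.
by rewrite addr_ge0 ?divr_ge0 ?mulr_ge0 ?inv_powR_le1 ?fine_ge0 ?(ltW s0)//; lra.
Qed.

Lemma kernel_modulus_cvg0 (s : nat -> R) : s n @[n --> \oo] --> (0 : R) ->
  kernel_modulus (s n) @[n --> \oo] --> (0 : R).
Proof.
move=> s0.
have cvg_powR (A : R) : 0 < A -> A `^ s n @[n --> \oo] --> (1 : R).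
  move=> A0; rewrite (_ : (fun n => _) = (fun n => expR (s n * ln A))); last first.
    by apply/funext => n; rewrite /powR gt_eqF.
  rewrite -expR0 -(mul0r (ln A)).
  by apply: continuous_cvg; [exact: continuous_expR|exact: cvgMr_tmp].
have D0 : 0 < D by exact: lt_le_trans D1.
have -> : 0 = (1 - 1^-1) * fine (nu setT) + C * (1 - 1) / (1 - 1 / 2) :> R.
  by rewrite invr1 !subrr mul0r mulr0 mul0r addr0.
apply: cvgD.
  apply: cvgMr_tmp; apply: cvgB; first exact: cvg_cst.
  by apply: cvgV; [rewrite oner_neq0|exact: cvg_powR].
apply: cvgM.
  by apply: cvgMl_tmp; apply: cvgB; [exact: cvg_powR|exact: cvg_cst].
apply: cvgV; first by apply/eqP; lra.
apply: cvgB; first exact: cvg_cst.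
by apply: cvgMr_tmp; exact: cvg_powR.
Qed.

(** The function p is a coordinate and e the distance to a point whose
    coordinate is a; only the slabs of p are measured. *)
Lemma integral_kernel_le (s : R) (a : R) (e : T -> R) : 0 < s < 1 ->
  measurable_fun setT e ->
  {ae nu, forall y, `|a - p y| <= e y <= D} ->
  (\int[nu]_y `|(e y `^ s)^-1 - 1|%:E <= (kernel_modulus s)%:E)%E.
Proof.
move=> s01 me eD; have /andP[s0 s1] := s01; set q := 2 `^ s.
pose S k := [set y | `|a - p y| <= 2^-1 ^+ k].
have mS k : measurable (S k).
  rewrite [S k](_ : _ = (fun y => `|a - p y|) @^-1` `]-oo, 2^-1 ^+ k]).
    rewrite -[X in measurable X]setTI; apply: measurableT_comp => //.
    exact: measurable_funB.
  by apply/seteqP; split => y /=; rewrite in_itv.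
have q1 : 1 < q by exact: powR2_gt1.
have q2 : q < 2 by exact: powR2_lt2.
have b0 k : 0 <= q ^+ k * (q - 1) by rewrite mulr_ge0 ?exprn_ge0; lra.
have P0 := inv_powR_le1 (ltW s0).
pose b k y := (q ^+ k * (q - 1) * \1_(S k) y)%:E.
have b_ge0 k y : (0 <= b k y)%E by rewrite lee_fin mulr_ge0.
have mb k : measurable_fun setT (b k).
  by apply/measurable_EFinP/measurable_funM => //; exact: measurable_indic.
apply: (@le_trans _ _ (\int[nu]_y ((1 - (D `^ s)^-1)%:E + \sum_(0 <= k <oo) b k y))%E).
  apply: ae_ge0_le_integral => //.
  - apply/measurable_EFinP; apply: measurableT_comp => //; apply: measurable_funB => //.
    under eq_fun do rewrite -powRN.
    exact: (measurableT_comp (measurable_powR _) me).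
  - by move=> y _; rewrite adde_ge0// nneseries_ge0.
  - by apply: emeasurable_funD => //; exact: ge0_emeasurable_sum.
  apply: filterS eD => y ey _.
  have [N yN] := norm_inv_powR_sub1_le s0 D1 ey.
  apply: (@le_trans _ _ ((1 - (D `^ s)^-1)%:E + \sum_(0 <= k < N) b k y)%E).
    rewrite sumEFin -EFinD lee_fin; apply: (le_trans yN).
    rewrite lerD2l; apply: ler_sum => k _; rewrite /b indicE.
    by rewrite mem_setE.
  by rewrite leeD2l//; exact: nneseries_lim_ge.
rewrite ge0_integralD//; last 2 first.
- by move=> y _; exact: nneseries_ge0.
- exact: ge0_emeasurable_sum.
rewrite integral_cst//= -[nu setT]fineK ?fin_num_measure// -EFinM.
rewrite /kernel_modulus EFinD leeD2l// integral_nneseries//.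
apply: (@le_trans _ _ (\sum_(0 <= k <oo) (C * (q - 1) * (q / 2) ^+ k)%:E)%E).
  apply: lee_nneseries => k; first by move=> _ _; exact: integral_ge0.
  move=> _; under eq_integral do rewrite /b EFinM.
  rewrite ge0_integralZl//=; last 2 first.
  - exact/measurable_EFinP/measurable_indic.
  - by rewrite lee_fin.
  rewrite integral_indic// setIT.
  apply: (@le_trans _ _ ((q ^+ k * (q - 1))%:E * (C * 2^-1 ^+ k)%:E)%E).
    by apply: lee_wpmul2l; rewrite ?lee_fin//; apply: slab; rewrite exprn_ge0 ?invr_ge0.
  by rewrite -EFinM lee_fin exprMn; lra.
apply: nneseries_EFin_le => [k|n].
  by rewrite !mulr_ge0 ?exprn_ge0 ?divr_ge0//; lra.
rewrite -mulr_sumr ler_wpM2l ?mulr_ge0 ?sum_expr_le//; first by lra.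
by apply/andP; split; lra.
Qed.

End singular_integral.

(** * Euclidean norm, boxes and slabs *)

Section euclidean.
Context {R : realType}.

Lemma euclidean_normN n (x : 'rV[R]_n) : euclidean_norm (- x) = euclidean_norm x.
Proof.
by rewrite /euclidean_norm; under eq_bigr do rewrite mxE sqrrN.
Qed.

Lemma norm_coord_le_euclidean n (x : 'rV[R]_n) i :
  `|x ord0 i| <= euclidean_norm x.
Proof.
rewrite -sqrtr_sqr ler_wsqrtr// (bigD1 i)//= lerDl.
by apply: sumr_ge0 => j _; exact: sqr_ge0.
Qed.

Lemma euclidean_norm_le n (x : 'rV[R]_n) (M : R) :
  (forall i, `|x ord0 i| <= M) -> euclidean_norm x <= Num.sqrt (n%:R * M ^+ 2).
Proof.
move=> xM; rewrite ler_wsqrtr//.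
apply: (@le_trans _ _ (\sum_(i < n) M ^+ 2)).
  apply: ler_sum => i _; rewrite -[leLHS]real_normK ?num_real//.
  by rewrite lerXn2r ?nnegrE// (le_trans _ (xM i)).
by rewrite sumr_const card_ord mulr_natl.
Qed.

Lemma measurable_euclidean_norm_sub n :
  measurable_fun setT
    (fun z : 'rV[R]_n * 'rV[R]_n => euclidean_norm (z.1 - z.2)).
Proof.
apply: (measurableT_comp (continuous_measurable_fun (@sqrt_continuous R))).
apply: measurable_sum => i; apply: measurable_funX.
under eq_fun do rewrite !mxE.
apply: measurable_funB.
- exact: (measurableT_comp (@measurable_coord_rV R n i) measurable_fst).
- exact: (measurableT_comp (@measurable_coord_rV R n i) measurable_snd).
Qed.

Definition box n (M : R) : set 'rV[R]_n := [set v | forall i, `|v ord0 i| <= M].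

Lemma measurable_coord_ball n (i : 'I_n) (a r : R) :
  measurable [set v : 'rV[R]_n | `|a - v ord0 i| <= r].
Proof.
rewrite [X in measurable X](_ : _ = (fun v : 'rV[R]_n => v ord0 i : measurableTypeR R) @^-1`
  `[a - r, a + r]).
  by rewrite -[X in measurable X]setTI; exact: measurable_coord_rV.
by apply/seteqP; split => v /=; rewrite in_itv/= -ler_distlC distrC.
Qed.

Lemma measurable_box n M : measurable (@box n M).
Proof.
rewrite [box _](_ : _ =
  \bigcap_(i in [set: 'I_n]) [set v : 'rV[R]_n | `|0 - v ord0 i| <= M]).
  by apply: fin_bigcap_measurable => // i _; exact: measurable_coord_ball.
apply/seteqP; split => v /= vM i; first by move=> _ /=; rewrite sub0r normrN.
by have := vM i I; rewrite /= sub0r normrN.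
Qed.

(** The preimage of a slab of the box under the map that defines the measure on
    'rV_n.+1 lies in the product of an interval and a box of 'rV_n. *)
Lemma lebesgue_rV_slab n (M a r : R) : 0 <= r ->
  (lebesgue_rV R n.+1
     ([set v : 'rV[R]_n.+1 | (`|a - v ord0 ord0| <= r)%R] `&` @box n.+1 M)
     <= (2 * r)%:E * lebesgue_rV R n (@box n M))%E.
Proof.
move=> r0.
pose S : set 'rV[R]_n.+1 := [set v : 'rV[R]_n.+1 | `|a - v ord0 ord0| <= r] `&` @box n.+1 M.
have mS : measurable S.
  by apply: measurableI; [exact: measurable_coord_ball|exact: measurable_box].
pose I : set (measurableTypeR R) := [set` `[a - r, a + r]].
have -> : (2 * r)%:E = lebesgue_measure I.
  rewrite lebesgue_measure_itv/= lte_fin; case: ltP => h.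
    by rewrite -EFinB; congr EFin; lra.
  by congr EFin; lra.
rewrite -product_measure1E; [|exact: measurable_itv|exact: measurable_box].
change ((@lebesgue_measure R \x lebesgue_rV R n)%E (@consrV R n @^-1` S) <=
  (@lebesgue_measure R \x lebesgue_rV R n)%E (I `*` @box n M))%E.
apply: le_measure; rewrite ?inE.
- by rewrite -[X in measurable X]setTI; exact: (@measurable_consrV R n measurableT _ mS).
- by apply: measurableX; [exact: measurable_itv|exact: (@measurable_box n M)].
move=> [t w] [/= tr wM]; rewrite consrV0/= in tr; split => /=.
  by rewrite /I/= in_itv/= -ler_distlC.
by move=> i; have := wM (lift ord0 i); rewrite consrV_lift.
Qed.

Lemma lebesgue_rV_box_lty n M : (lebesgue_rV R n (@box n M) < +oo)%E.
Proof.
elim: n => [|n ih]; first by rewrite /= diracE ltry.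
pose N := Num.max 0 M.
have N0 : 0 <= N by rewrite le_max lexx.
apply: (@le_lt_trans _ _ ((2 * N)%:E * lebesgue_rV R n (@box n M))%E); last first.
  by rewrite lte_mul_pinfty// lee_fin mulr_ge0.
apply: le_trans (@lebesgue_rV_slab n M 0 N N0).
apply: le_measure; rewrite ?inE.
- exact: measurable_box.
- by apply: measurableI; [exact: measurable_coord_ball|exact: measurable_box].
move=> v vM; split => //=; rewrite sub0r normrN (le_trans (vM ord0))//.
by rewrite le_max lexx orbT.
Qed.

Lemma bounded_set_box n (A : set 'rV[R]_n) : bounded_set A ->
  exists2 M, 0 <= M & A `<=` box M.
Proof.
move=> [M [_ AM]]; pose N := Num.max 0 (M + 1).
exists N; first by rewrite le_max lexx.
move=> v Av i.
have vN : `|v| <= N by apply: AM => //; rewrite lt_max ltrDl ltr01 orbT.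
apply: le_trans vN.
rewrite [leRHS](_ : _ = mx_norm v)// mx_normrE.
exact: (le_bigmax _ (fun ij : 'I_1 * 'I_n => `|v ij.1 ij.2|) (ord0, i)).
Qed.

End euclidean.

(** * Elements of L^2 as functions *)

Section L2_classes.
Context {d} {T : measurableType d} {R : realType}.
Variable nu : {measure set T -> \bar R}.
Local Open Scope quotient_scope.

Lemma Lspace2_Lfun (u : LspaceType2 nu) : (u : T -> R) \in Lfun nu 2%:E.
Proof.
rewrite inE; apply/andP; split; rewrite inE/=; last exact: Lebesgue_finite.
exact: (@measurable_funPT _ _ _ _ (repr (u : {mfun_ nu, T >-> measurableTypeR R}))).
Qed.

Lemma Lspace2_of_Lfun (v : T -> R) : v \in Lfun nu 2%:E ->
  exists V : LspaceType2 nu, {ae nu, forall x, (V : T -> R) x = v x}.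
Proof.
move=> v2; have mv := Lfun2_measurable v2.
pose bv := isMeasurableFun.Build _ _ T (measurableTypeR R) v mv.
pose f : {mfun T >-> measurableTypeR R} := HB.pack v bv.
pose F : {mfun_ nu, T >-> measurableTypeR R} := \pi f.
have Ff : {ae nu, forall x, (F : T -> R) x = v x}.
  have /eqP := reprK F; rewrite eqmodE => /asboolP.
  by apply: filterS => x /(_ I).
have Ffin : finite_norm nu 2%:E (F : T -> R).
  have mF : measurable_fun setT (F : T -> R).
    exact: (@measurable_funPT _ _ _ _ (repr F)).
  have F2 : (F : T -> R) \in Lfun nu 2%:E.
    apply: Lfun2_of_sqr => //.
    rewrite (@ae_eq_integral _ _ _ nu setT (fun x => (v x ^+ 2)%:E))//.
    - by apply: integrable_lty => //; exact: Lfun2_integrable_sqr.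
    - by apply/measurable_EFinP; exact: measurable_funX.
    - by apply/measurable_EFinP; exact: measurable_funX.
    - by apply: filterS Ff => x -> _.
  by have := sub_Lfun_finLfun F2; rewrite inE.
pose bF := isFinLebesgue.Build _ _ _ nu _ (lee1n 2) F Ffin.
pose V : LspaceType nu (lee1n 2) := HB.pack F bF.
by exists V.
Qed.
End L2_classes.

(** * Restricted measures *)

Section restriction.
Context {d} {T : measurableType d} {R : realType}.
Variables (mu : {measure set T -> \bar R}) (D : set T) (mD : measurable D).

Lemma ae_mrestr : {ae mrestr mu mD, forall x, D x}.
Proof.
exists (~` D); split; [exact: measurableC| |by []].
by rewrite /= /mrestr setICl measure0.
Qed.

Lemma Rintegral_mrestr (f : T -> R) : measurable_fun setT f ->
  \int[mu]_(x in D) f x = \int[mrestr mu mD]_x f x.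
Proof.
move=> mf; congr fine.
rewrite (@eq_measure_integral _ _ _ D (mrestr mu mD)); last first.
  by move=> A mA AD /=; rewrite /mrestr setIidl.
have ND : mrestr mu mD (~` D) = 0%E by rewrite /= /mrestr setICl measure0.
have ge0 (g : T -> \bar R) : measurable_fun setT g -> (forall x, 0 <= g x)%E ->
    (\int[mrestr mu mD]_(x in D) g x = \int[mrestr mu mD]_x g x)%E.
  move=> mg g0; rewrite [RHS](@ge0_negligible_integral _ _ _ _ _ (~` D))//.
    by rewrite setTD setCK.
  exact: measurableC.
have mfE : measurable_fun setT (EFin \o f) by exact/measurable_EFinP.
rewrite integralE [RHS]integralE !ge0//.
- exact: measurable_funeneg.
- exact: measurable_funepos.
Qed.

End restriction.

(** * The Riesz energy as a perturbation of the squared mean *)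

Definition riesz_density (R : realType) n (s : R) (u : 'rV[R]_n -> R)
    (z : 'rV[R]_n * 'rV[R]_n) : R :=
  u z.1 * u z.2 / euclidean_norm (z.1 - z.2) `^ s.

Section riesz_energy.
Context {R : realType} (m : nat).
Local Notation V := 'rV[R]_m.+1.
Variable nu : {finite_measure set V -> \bar R}.
Variables C D : R.
Hypothesis C0 : 0 <= C.
Hypothesis D1 : 1 <= D.
Hypothesis slab : forall a r : R, 0 <= r ->
  (nu [set y : V | (`|a - y ord0 ord0| <= r)%R] <= (C * r)%:E)%E.
Hypothesis diam :
  {ae nu, forall x, {ae nu, forall y, euclidean_norm (x - y) <= D}}.

Let k1 (s : R) (z : V * V) : R := (euclidean_norm (z.1 - z.2) `^ s)^-1 - 1.

Let measurable_k1 s : measurable_fun setT (k1 s).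
Proof.
apply: measurable_funB => //; under eq_fun do rewrite -powRN.
exact: (measurableT_comp (measurable_powR _) (@measurable_euclidean_norm_sub R m.+1)).
Qed.

Let k1_sym s x y : k1 s (x, y) = k1 s (y, x).
Proof. by rewrite /k1/= -euclidean_normN opprB. Qed.

Let k1_le s : 0 < s < 1 -> {ae nu, forall x,
  (\int[nu]_y `|k1 s (x, y)|%:E <= (kernel_modulus nu C D s)%:E)%E}.
Proof.
move=> s01; apply: filterS diam => x xD.
apply: (@integral_kernel_le _ _ R nu (fun y => y ord0 ord0) C D _ C0 D1 slab s
  (x ord0 ord0) (fun y => euclidean_norm (x - y))) => //.
- exact: measurable_coord_rV.
- exact: (measurableT_comp (@measurable_euclidean_norm_sub R m.+1)
    (pair1_measurable x)).
apply: filterS xD => y ->; rewrite andbT.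
by have := norm_coord_le_euclidean (x - y) ord0; rewrite !mxE.
Qed.

Section density.
Variables (s : R) (u : V -> R).
Hypothesis s01 : 0 < s < 1.
Hypothesis u2 : u \in Lfun nu 2%:E.

(* The factor 1 presents the constant part as a Schur kernel too. *)
Let F1 (z : V * V) : R := u z.1 * u z.2 * 1.
Let F2 (z : V * V) : R := u z.1 * u z.2 * k1 s z.

Let integrable_F1 : (nu \x nu)%E.-integrable setT (EFin \o F1).
Proof.
have one_le : {ae nu, forall x,
    (\int[nu]_y `|cst 1 (x, y)|%:E <= (fine (nu setT))%:E)%E}.
  apply: nearW => x.
  by rewrite /= normr1 integral_cst// mul1e fineK// fin_num_measure.
by have [] := schur_test (measurable_cst _) (fun _ _ => erefl)
  (fine_ge0 (measure_ge0 _ _)) one_le u2.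
Qed.

Let F2P : (nu \x nu)%E.-integrable setT (EFin \o F2) /\
  `|\int[(nu \x nu)%E]_z F2 z| <= kernel_modulus nu C D s * \int[nu]_x (u x ^+ 2).
Proof.
exact: (schur_test (measurable_k1 s) (k1_sym s)
  (kernel_modulus_ge0 nu C0 D1 s01) (k1_le s01) u2).
Qed.

Let riesz_densityE : riesz_density s u = (fun z => F1 z + F2 z).
Proof. by apply/funext => z; rewrite /riesz_density /F1 /F2 /k1; ring. Qed.

Lemma integrable_riesz_density :
  (nu \x nu)%E.-integrable setT (EFin \o riesz_density s u).
Proof. by rewrite riesz_densityE; exact: (integrableD _ integrable_F1 F2P.1). Qed.

(** The part F1 of the density integrates to the squared mean, and the Schur test
    bounds the part F2. *)
Lemma energy_sub_sqr_le :
  `|\int[nu]_x \int[nu]_y riesz_density s u (x, y) - (\int[nu]_x u x) ^+ 2|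
    <= kernel_modulus nu C D s * \int[nu]_x (u x ^+ 2).
Proof.
rewrite (Rintegral_prod integrable_riesz_density) riesz_densityE.
rewrite RintegralD//; last exact: F2P.1.
suff -> : \int[(nu \x nu)%E]_z F1 z = (\int[nu]_x u x) ^+ 2.
  by rewrite addrAC subrr add0r F2P.2.
rewrite -(Rintegral_prod integrable_F1) expr2.
have iu : nu.-integrable setT (EFin \o u).
  by apply/Lfun1_integrable/Lfun_subset12 => //; exact: fin_num_measure.
rewrite -RintegralZl//; apply: eq_Rintegral => x _; rewrite mulrC -RintegralZl//.
by apply: eq_Rintegral => y _; rewrite /F1/= mulr1.
Qed.

End density.

End riesz_energy.

(** * Bounded domains *)

Section bounded_domain.
Context {R : realType} (m : nat).
Variables (Omega : set 'rV[R]_m.+1) (oO : open Omega) (bO : bounded_set Omega).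
Local Notation V := 'rV[R]_m.+1.
Local Notation mu := (lebesgue_rV R m.+1).

Let Omega_lty : (mu Omega < +oo)%E.
Proof.
have [M _ OM] := bounded_set_box bO.
apply: le_lt_trans (lebesgue_rV_box_lty m.+1 M).
by apply: le_measure; rewrite ?inE; [exact: open_measurable_rV|exact: measurable_box|].
Qed.

(* This measure is convertible to the restricted measure in the definition of L2,
   and carries the finiteness needed for product measures. *)
Let nu : {finite_measure set V -> \bar R} :=
  mfrestr (open_measurable_rV oO) Omega_lty.

Let ae_Omega : {ae nu, forall x, Omega x}.
Proof. exact: ae_mrestr. Qed.

Let RintegralE (f : V -> R) : measurable_fun setT f ->
  \int[mu]_(x in Omega) f x = \int[nu]_x f x.
Proof. exact: Rintegral_mrestr. Qed.

Let L2_Lfun (u : L2 oO) : (u : V -> R) \in Lfun nu 2%:E.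
Proof. exact: Lspace2_Lfun. Qed.

Let L2_of_Lfun (v : V -> R) : v \in Lfun nu 2%:E ->
  exists w : L2 oO, {ae nu, forall x, w x = v x}.
Proof. exact: Lspace2_of_Lfun. Qed.

Let slab : exists2 C : R, 0 <= C & forall a r : R, 0 <= r ->
  (nu [set y : V | (`|a - y ord0 ord0| <= r)%R] <= (C * r)%:E)%E.
Proof.
have [M _ OM] := bounded_set_box bO.
exists (2 * fine (lebesgue_rV R m (@box R m M))); first by rewrite mulr_ge0 ?fine_ge0.
move=> a r r0; rewrite mulrAC EFinM fineK; last first.
  by rewrite ge0_fin_numE// lebesgue_rV_box_lty.
apply: le_trans (lebesgue_rV_slab m M a r0).
change (mu ([set y : V | (`|a - y ord0 ord0| <= r)%R] `&` Omega) <=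
  mu ([set y : V | (`|a - y ord0 ord0| <= r)%R] `&` box M))%E.
apply: (@le_measure _ _ _ mu); rewrite ?inE.
- by apply: measurableI; [exact: measurable_coord_ball|exact: open_measurable_rV].
- by apply: measurableI; [exact: measurable_coord_ball|exact: measurable_box].
- exact: setIS.
Qed.

Let diam : exists2 D : R, 1 <= D &
  {ae nu, forall x, {ae nu, forall y, euclidean_norm (x - y) <= D}}.
Proof.
have [M _ OM] := bounded_set_box bO.
exists (Num.max 1 (Num.sqrt (m.+1%:R * (2 * M) ^+ 2))); first by rewrite le_max lexx.
apply: filterS ae_Omega => x Ox; apply: filterS ae_Omega => y Oy.
rewrite le_max; apply/orP; right; apply: euclidean_norm_le => i.
rewrite !mxE (le_trans (ler_normB _ _))//.
by have := OM x Ox i; have := OM y Oy i; lra.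
Qed.

(** The quantitative form of the theorem: on bounded sets of L^2 the convergence of
    J to Jd is uniform, at a rate that depends only on the domain. *)
Lemma J_sub_Jd_le : exists eta : R -> R,
  (forall s : nat -> R, s n @[n --> \oo] --> (0 : R) ->
     eta (s n) @[n --> \oo] --> (0 : R)) /\
  forall (alpha : R) (u : L2 oO), 0 < m.+1%:R - alpha < 1 ->
    `|J alpha u - Jd u| <=
      eta (m.+1%:R - alpha) * \int[mu]_(x in Omega) (u x ^+ 2).
Proof.
have [C C0 slabC] := slab; have [D D1 diamD] := diam.
exists (kernel_modulus nu C D); split => [s|alpha u s01].
  exact: kernel_modulus_cvg0.
have u2 := L2_Lfun u; have mu2 := Lfun2_measurable u2.
have iF := integrable_riesz_density C0 D1 slabC diamD s01 u2.
have mF := measurable_int _ iF.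
rewrite RintegralE; last exact: measurable_funX.
rewrite /J /Jd.
have -> : \int[mu]_(x in Omega) \int[mu]_(y in Omega)
    (u x * u y / euclidean_norm (x - y) `^ (m.+1%:R - alpha)) =
    \int[nu]_x \int[nu]_y (u x * u y / euclidean_norm (x - y) `^ (m.+1%:R - alpha)).
  rewrite -RintegralE.
    apply: eq_Rintegral => x _; apply: RintegralE.
    by move/measurable_EFinP : mF => mF;
      exact: (measurableT_comp mF (pair1_measurable x)).
  apply: (measurableT_comp (@fine_measurable R setT measurableT)).
  exact: (measurable_fubini_F iF).
rewrite (RintegralE mu2) -opprD normrN.
exact: (energy_sub_sqr_le C0 D1 slabC diamD s01 u2).
Qed.

Lemma L2_weak_cvg_bounded (u_ : nat -> L2 oO) (u : L2 oO) : L2_weak_cvg u_ u ->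
  exists B : R, forall n, \int[mu]_(x in Omega) (u_ n x ^+ 2) <= B.
Proof.
move=> uw.
have [|v v2|B uB] := @Lfun2_uniform_boundedness _ _ R nu (fun n => u_ n : V -> R).
- by move=> n; exact: L2_Lfun.
- have [w wv] := L2_of_Lfun v2.
  have /cvg_seq_bounded[B [_ /(_ (B + 1))]] :
      cvgn (fun n => \int[mu]_(x in Omega) (u_ n x * w x)).
    by apply/cvg_ex; eexists; exact: uw.
  rewrite ltrDl ltr01 => /(_ isT) uB; exists (B + 1) => n.
  have := uB n I; rewrite /=.
  have m1 := Lfun2_measurable (L2_Lfun (u_ n)).
  have m2 := Lfun2_measurable (L2_Lfun w).
  rewrite RintegralE; last exact: measurable_funM.
  rewrite (_ : \int[nu]_x (u_ n x * w x) = \int[nu]_x (u_ n x * v x))//.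
  congr fine; apply: ae_eq_integral => //.
  + by apply/measurable_EFinP; exact: measurable_funM.
  + by apply/measurable_EFinP/measurable_funM => //; exact: Lfun2_measurable v2.
  + by apply: filterS wv => x -> _.
exists B => n; rewrite RintegralE; first exact: uB.
by apply: measurable_funX; exact: Lfun2_measurable (L2_Lfun (u_ n)).
Qed.

(** On a domain of finite measure the constant 1 is an admissible test
    function. *)
Lemma L2_weak_cvg_integral (u_ : nat -> L2 oO) (u : L2 oO) : L2_weak_cvg u_ u ->
  \int[mu]_(x in Omega) u_ n x @[n --> \oo] --> \int[mu]_(x in Omega) u x.
Proof.
move=> uw.
have [w w1] := L2_of_Lfun (Lfun_cst nu 1 2).
have mw := Lfun2_measurable (L2_Lfun w).
have E (v : L2 oO) : \int[mu]_(x in Omega) v x = \int[mu]_(x in Omega) (v x * w x).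
  have mv := Lfun2_measurable (L2_Lfun v).
  rewrite !RintegralE//; last exact: measurable_funM.
  congr fine; apply: ae_eq_integral => //.
  - exact/measurable_EFinP.
  - by apply/measurable_EFinP; exact: measurable_funM.
  - by apply: filterS w1 => x -> _; rewrite mulr1.
by rewrite E; under eq_fun do rewrite E; exact: uw.
Qed.

Lemma J_cvg (alpha_ : nat -> R) (u_ : nat -> L2 oO) (u : L2 oO) :
  alpha_ @ \oo --> (m.+1%:R : R)^'- -> L2_weak_cvg u_ u ->
  J (alpha_ n) (u_ n) @[n --> \oo] --> Jd u.
Proof.
move=> ad uw.
have [eta [eta0 Jeta]] := J_sub_Jd_le.
have [B uB] := L2_weak_cvg_bounded uw.
have s0 : m.+1%:R - alpha_ n @[n --> \oo] --> (0 : R).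
  rewrite -(subrr (m.+1%:R : R)); apply: cvgB; first exact: cvg_cst.
  by apply: (cvg_trans ad); exact: cvg_within.
have s01 : \forall n \near \oo, 0 < m.+1%:R - alpha_ n < 1.
  have d1 : m.+1%:R - 1 < m.+1%:R :> R by rewrite ltrBlDr ltrDl.
  have lt_d := ad _ (nbhs_left_lt (m.+1%:R : R)).
  have gt_d := ad _ (nbhs_left_gt d1).
  near=> n; apply/andP; split.
    by rewrite subr_gt0; near: n; exact: lt_d.
  by rewrite ltrBlDr addrC -ltrBlDr; near: n; exact: gt_d.
have Jd_cvg : Jd (u_ n) @[n --> \oo] --> Jd u.
  apply: cvgN; rewrite expr2; under eq_fun do rewrite expr2.
  by apply: cvgM; exact: L2_weak_cvg_integral.
have diff0 : J (alpha_ n) (u_ n) - Jd (u_ n) @[n --> \oo] --> (0 : R).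
  apply/norm_cvg0P.
  apply: (@squeeze_cvgr _ _ _ _ (cst 0) (fun n => `|eta (m.+1%:R - alpha_ n)| * `|B|)).
  - near=> n; rewrite normr_ge0/=.
    apply: (le_trans (Jeta _ _ _)); first by near: n.
    rewrite (le_trans (ler_norm _))// normrM ler_wpM2l// ger0_norm.
      by rewrite (le_trans (uB n))// ler_norm.
    by apply: Rintegral_ge0 => x _; exact: sqr_ge0.
  - exact: cvg_cst.
  - rewrite -(mul0r `|B|); apply: cvgMr_tmp.
    by apply/norm_cvg0P; exact: eta0.
have -> : (fun n => J (alpha_ n) (u_ n)) =
    (fun n => (J (alpha_ n) (u_ n) - Jd (u_ n)) + Jd (u_ n)).
  by apply/funext => n; rewrite subrK.
by rewrite -[Jd u]add0r; exact: cvgD.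
Unshelve. all: by end_near. Qed.

End bounded_domain.

(** Continuous convergence is stronger than Gamma-convergence, and stable under
    change of sign: the liminf inequality holds with equality, and constant
    sequences are recovery sequences. *)
Lemma gamma_cvg_left_of_cvg (R : realType) (X : Type)
    (cvg : (nat -> X) -> X -> Prop) (d : R) (F : R -> X -> R) (F0 : X -> R) :
  (forall x, cvg (fun=> x) x) ->
  (forall a_ : nat -> R, a_ @ \oo --> d^'- ->
    forall u_ u, cvg u_ u -> F (a_ n) (u_ n) @[n --> \oo] --> F0 u) ->
  gamma_cvg_left cvg d F F0.
Proof.
move=> cst_cvg Fcvg a_ _ ad; split=> [u_ u uu|u].
- have FE : (F (a_ n) (u_ n))%:E @[n --> \oo] --> (F0 u)%:E.
    by apply: cvg_EFin; [exact: nearW|exact: Fcvg].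
  by rewrite (cvg_limn_einf_sup FE).1.
- by exists (fun=> u) => //; exact: (Fcvg _ ad _ _ (cst_cvg u)).
Qed.

Theorem theorem3p1 (R : realType) (d : nat) (d_ge1 : (1 <= d)%N)
    (Omega : set 'rV[R]_d) (oO : open Omega) (bO : bounded_set Omega)
    (lO : lipschitz_boundary Omega) :
  [/\ forall alpha_ : nat -> R,
        (forall n, 0 < alpha_ n < d%:R) ->
        alpha_ @ \oo --> (d%:R : R)^'- ->
        forall (u : L2 oO) (u_ : nat -> L2 oO), L2_weak_cvg u_ u ->
          J (alpha_ n) (u_ n) @[n --> \oo] --> Jd u,
      gamma_cvg_left (@L2_weak_cvg R d Omega oO) d%:R
        (fun alpha u => J alpha u) (fun u => Jd u)
    & gamma_cvg_left (@L2_weak_cvg R d Omega oO) d%:R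
        (fun alpha u => - J alpha u) (fun u => - Jd u)].
Proof.
case: d d_ge1 Omega oO bO lO => [//|m] _ Omega oO bO _.
have cst_cvg (u : L2 oO) : L2_weak_cvg (fun=> u) u by move=> v; exact: cvg_cst.
split; first by move=> alpha_ _ ad u u_ uu; exact: J_cvg.
- by apply: gamma_cvg_left_of_cvg => // a_ ad u_ u uu; exact: J_cvg.
- by apply: gamma_cvg_left_of_cvg => // a_ ad u_ u uu; apply: cvgN; exact: J_cvg.
Qed.
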